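(* Let $p$ be an odd prime, $n$ a positive integer, $q=p^n$, and for $c\in\mathbb{F}_q$ let $\psi_c(x)=\exp\!\big(2\pi i\operatorname{tr}_{q,p}(cx)/p\big)$. Let $a_1,\dots,a_s,b\in\mathbb{F}_q$ and let $t_1,\dots,t_s$ be positive integers dividing $n$. Let $\chi^{(j)}$ denote the quadratic character of $\mathbb{F}_{p^{t_j}}$ and $i$ the imaginary unit. Then the number of tuples $(x_1,\dots,x_s)$ with $x_j\in\mathbb{F}_{p^{t_j}}$ satisfying $a_1x_1^2+\cdots+a_sx_s^2=b$ equals $$p^{\frac{t_1+\cdots+t_s}{2}-n}\sum_{c\in\mathbb{F}_q}\psi_c(-b)\prod_{j=1}^s\Gamma_j(c),$$ where $$\Gamma_j(c)=\begin{cases}p^{t_j/2},&\text{if }\operatorname{tr}_{q,p^{t_j}}(ca_j)=0;\\ -(-1)^{t_j}\chi^{(j)}\big(\operatorname{tr}_{q,p^{t_j}}(ca_j)\big),&\text{if }\operatorname{tr}_{q,p^{t_j}}(ca_j)\ne0\text{ and }p\equiv1\pmod4;\\ -(-1)^{t_j}i^{t_j}\chi^{(j)}\big(\operatorname{tr}_{q,p^{t_j}}(ca_j)\big),&\text{if }\operatorname{tr}_{q,p^{t_j}}(ca_j)\ne0\text{ and }p\equiv3\pmod4.\end{cases}$$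
   Context: For $k\mid n$, $\operatorname{tr}_{q,p^{k}}$ denotes the trace map from $\mathbb{F}_q$ to $\mathbb{F}_{p^{k}}$. *)

(* Defs.v *)
From HB Require Import structures.
From mathcomp Require Import all_boot all_order all_algebra all_field.
From mathcomp Require Import all_classical all_reals.
From mathcomp Require Import trigo.
From mathcomp Require Import complex.
Unset Printing Implicit Defensive.
Import Order.TTheory GRing.Theory Num.Theory.
Local Open Scope ring_scope.

(* Setting: F is a finite field with #|F| = q = p^n (p a prime).            *)
(* The subfield F_{p^t} of F (for t | n) is the set of fixed points of x |-> x^(p^t). *)
Definition subF (F : finFieldType) (p t : nat) : {set F} :=
  [set x : F | x ^+ (p ^ t) == x].

Definition trF (F : finFieldType) (p n t : nat) (x : F) : F :=
  \sum_(k < n %/ t) x ^+ (p ^ (t * k)).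

Definition prime_rep (F : finFieldType) (p : nat) (y : F) : nat :=
  odflt 0%N (omap (@nat_of_ord p) [pick k : 'I_p | (k%:R : F) == y]).

Definition psi (R : realType) (F : finFieldType) (p n : nat) (c x : F) : R[i] :=
  let k := prime_rep F p (trF F p n 1 (c * x)) in
  Complex (cos (2 * pi * k%:R / p%:R)) (sin (2 * pi * k%:R / p%:R)).

Definition qchar (R : realType) (F : finFieldType) (p t : nat) (y : F) : R[i] :=
  if y == 0 then 0
  else if [exists z in subF F p t, z ^+ 2 == y] then 1 else -1.

Definition Gamma (R : realType) (F : finFieldType) (p n t : nat) (u c : F) : R[i] :=
  let T := trF F p n t (c * u) in
  if T == 0 then Complex ((Num.sqrt (p%:R : R)) ^+ t) 0
  else if (p %% 4 == 1)%N then - (-1) ^+ t * qchar R F p t T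
  else - (-1) ^+ t * (Complex 0 1) ^+ t * qchar R F p t T.

(* Main.v *)
Require Import Defs.
From HB Require Import structures.
From mathcomp Require Import all_boot all_order all_algebra all_field.
From mathcomp Require Import all_classical all_reals.
From mathcomp Require Import trigo.
From mathcomp Require Import complex.
From mathcomp Require Import ring.
Import Order.TTheory GRing.Theory Num.Theory.
Local Open Scope ring_scope.
Set Implicit Arguments.
Unset Strict Implicit.
Unset Printing Implicit Defensive.

(* Orthogonality of additive characters turns the count into a sum over c of
   products of sums of psi_c (a_j y^2) over the subfields F_(p^t_j), and the
   tower law for traces makes each factor the quadratic Gauss sum of
   T = tr (c a_j). In a basis e of F_(p^t) over F_p this is the Gauss sum of the
   quadratic form with matrix E diag(T^(p^j)) E^T, where E = (e_i^(p^j)); over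
   F_p it equals chi(det) g^t, by completing squares. Frobenius permutes the
   columns of E cyclically, so (det E)^(p-1) = (-1)^(t-1), and Euler's criterion
   gives chi(det) = (-1)^(t-1) chi_t(T). The value of the prime Gauss sum g is
   obtained from its factorisation as a signed product of the numbers
   z^(mk) (z^k - 1) for 1 <= k <= m = (p-1)/2. *)

(** * Euler criterion *)

(** Euler's criterion serves as the definition, so multiplicativity comes from powers; the link with
    squares is [expf_half_sqr]. Values lie in [K], where the character sums live. *)
Definition legendre (F : finFieldType) (K : pzRingType) (x : F) : K :=
  if x == 0 then 0 else if x ^+ (#|F|.-1./2) == 1 then 1 else -1.

Section Legendre.
Variables (F : finFieldType) (K : nzRingType).
Hypothesis oddF : odd #|F|.
Notation h := (#|F|.-1./2).
Implicit Types x y : F.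

Lemma card_pred_half : (h.*2 = #|F|.-1)%N.
Proof. by rewrite even_halfK // -subn1 oddB ?oddF //; apply/card_gt0P; exists 0. Qed.

Lemma expf_pred_card x : x != 0 -> x ^+ #|F|.-1 = 1.
Proof.
move=> x0; apply: (mulfI x0); rewrite -exprS mulr1 prednK ?expf_card //.
by apply/card_gt0P; exists 0.
Qed.

Lemma expf_half x : x != 0 -> x ^+ h = 1 \/ x ^+ h = -1.
Proof.
move=> x0; have /eqP : (x ^+ h) ^+ 2 = 1 by rewrite -exprM muln2 card_pred_half expf_pred_card.
by rewrite sqrf_eq1 => /orP[]/eqP; [left|right].
Qed.

Lemma two_neq0 : 2%:R != 0 :> F.
Proof.
apply/negP => /eqP two0.
have p2 : 2%N \in [pchar F] by rewrite inE /= two0 eqxx.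
have [n _ cF] : {n | prime 2 & #|F| = (2 ^ n)%N}.
  by exists (logn 2 #|F|) => //; rewrite -(card_pprimeChar p2).
move: oddF (finNzRing_gt1 F); rewrite cF oddX.
by case: (n).
Qed.

Lemma oneN1 : (1 == -1 :> F) = false.
Proof. by rewrite -subr_eq0 opprK (negbTE two_neq0). Qed.

Lemma legendreM x y : legendre K (x * y) = legendre K x * legendre K y.
Proof.
rewrite /legendre mulf_eq0; case: eqP => [|/eqP x0]; first by rewrite mul0r.
case: eqP => [|/eqP y0]; first by rewrite mulr0.
rewrite /= exprMn; case: (expf_half x0) => ->; case: (expf_half y0) => ->.
all: by rewrite ?mulrNN ?mulr1 ?mul1r ?eqxx ?(eq_sym (-1)) ?oneN1 ?mulrNN ?mulr1 ?mul1r.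
Qed.

Lemma legendre_sqr x : x != 0 -> legendre K x * legendre K x = 1.
Proof.
by rewrite /legendre => /negbTE ->; case: ifP; rewrite ?mulrNN mulr1.
Qed.

(** For the converse, [x ^+ h = 1] makes X^2 - x divide (X^(2h) - 1) X = X^q - X with q = [#|F|];
    this splits over [F], so X^2 - x has a root there. *)
Lemma expf_half_sqr x : x != 0 -> (x ^+ h == 1) = [exists w, w ^+ 2 == x].
Proof.
move=> x0; apply/eqP/existsP => [xh|[w /eqP wx]]; last first.
  have w0 : w != 0 by apply: contraNneq x0 => w0; rewrite -wx w0 expr0n.
  by rewrite -wx -exprM mul2n card_pred_half expf_pred_card.
have q0 : (0 < #|F|)%N by apply/card_gt0P; exists 0.
have dv : ('X^2 - x%:P : {poly F}) %| 'X^#|F| - 'X.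
  have -> : ('X^#|F| - 'X : {poly F}) = ('X^2 ^+ h - x%:P ^+ h) * 'X.
    by rewrite -exprM mul2n card_pred_half -rmorphXn xh /= mulrBl mul1r -exprSr prednK.
  by rewrite subrXX -mulrA dvdp_mulr.
move: dv; rewrite finField_genPoly => /dvdp_prod_XsubC[m eqm].
have := eqp_size eqm; rewrite size_XnsubC // size_prod_XsubC => -[].
case E : (mask _ _) => [//|w s] _; exists w.
have : root ('X^2 - x%:P) w by rewrite (eqp_root eqm) E root_prod_XsubC inE eqxx.
by rewrite rootE !hornerE subr_eq0.
Qed.

(** Fibres of squaring: zero has one square root, any other y has two or none. *)
Lemma sum_sqr (f : F -> K) :
  \sum_x f (x ^+ 2) = \sum_y (1 + legendre K y) * f y.
Proof.
rewrite (partition_big (fun x : F => x ^+ 2) predT) //=; apply: eq_bigr => y _.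
rewrite (eq_bigr (fun=> f y)); last by move=> x /eqP ->.
rewrite sumr_const -[f y *+ _]mulr_natl; congr (_ * _).
rewrite /legendre; case: eqP => [->|/eqP y0].
  rewrite addr0 -[1]/(1%:R); congr _%:R.
  by rewrite (@eq_card _ _ (pred1 0)) ?card1 // => x; apply: (expf_eq0 x 2).
rewrite expf_half_sqr //; case: ifPn => [/existsP[w /eqP wy]|/existsPn nw].
  have w0 : w != 0 by apply: contraNneq y0 => w0; rewrite -wy w0 expr0n.
  rewrite -[1 + 1]/(2%:R); congr _%:R.
  have cw : #|[set w; - w]| = 2%N.
    by rewrite cards2 -subr_eq0 opprK -mulr2n -mulr_natr mulf_neq0 ?two_neq0.
  rewrite (@eq_card _ _ (mem [set w; - w])) ?cw // => x.
  by rewrite in_set2 -wy; apply: eqf_sqr.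
rewrite subrr eq_card0 // => x; apply: negbTE (nw x).
Qed.
End Legendre.

(** * Gauss sums over the prime field *)

Section GaussSum.
Variables (p : nat) (K : fieldType) (z : K).
Hypotheses (p_pr : prime p) (p_odd : odd p) (z_prim : p.-primitive_root z).
Local Notation m := (p.-1./2).

Definition echar (x : 'F_p) : K := z ^+ x.

Definition gauss : K := \sum_(x : 'F_p) echar (x ^+ 2).

Let oddFp : odd #|'F_p|. Proof. by rewrite card_Fp. Qed.
Local Notation chi := (@legendre 'F_p K).

Lemma echar_nat i : echar i%:R = z ^+ i.
Proof. by rewrite /echar val_Fp_nat // prim_expr_mod. Qed.

Lemma echar0 : echar 0 = 1. Proof. by []. Qed.

Lemma natr_Fp (x : 'F_p) : (x : nat)%:R = x.
Proof. exact: natr_Zp. Qed.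

Lemma echarD x y : echar (x + y) = echar x * echar y.
Proof. by rewrite -[x in LHS]natr_Fp -[y in LHS]natr_Fp -natrD echar_nat exprD. Qed.

(** Once [d] is absorbed by a change of variable, translation by 1 multiplies the sum by [z], which
    is not 1. *)
Lemma sum_echar_lin d : d != 0 -> \sum_x echar (d * x) = 0.
Proof.
move=> d0; have z1 : z != 1.
  by rewrite -[z]expr1 -(prim_order_dvd z_prim) dvdn1 neq_ltn prime_gt1 ?orbT.
rewrite -(reindex_inj (mulfI d0) (P := predT) (F := echar)) /=.
apply: (mulfI (_ : z - 1 != 0)); rewrite ?subr_eq0 // mulr0 mulrBl mul1r.
apply/eqP; rewrite subr_eq0; apply/eqP.
rewrite [RHS](reindex_inj (addrI 1)) mulr_sumr; apply: eq_bigr => x _ /=.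
by rewrite echarD -[1 in RHS]/(1%:R) echar_nat.
Qed.

(** By [sum_sqr] and the vanishing of linear sums, both sides reduce to sums of chi(y) echar(c y);
    substituting y -> d y extracts chi(d). *)
Lemma gauss_twist d : d != 0 -> \sum_x echar (d * x ^+ 2) = chi d * gauss.
Proof.
move=> d0; rewrite /gauss.
have E c : c != 0 -> \sum_x echar (c * x ^+ 2) = \sum_y chi y * echar (c * y).
  move=> c0; rewrite (sum_sqr oddFp (fun x => echar (c * x))).
  under eq_bigr do rewrite mulrDl mul1r.
  by rewrite big_split /= sum_echar_lin ?add0r.
rewrite E //; have := E 1 (oner_neq0 _).
under eq_bigr do rewrite mul1r; move=> ->.
rewrite mulr_sumr [RHS](reindex_inj (mulfI d0)) /=; apply: eq_bigr => x _.
by rewrite mul1r legendreM // !mulrA legendre_sqr // mul1r.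
Qed.

Lemma double_predn_half : (m.*2 = p.-1)%N.
Proof. by have := card_pred_half oddFp; rewrite card_Fp. Qed.

Lemma predn_half_gt0 : (0 < m)%N.
Proof. by rewrite -double_gt0 double_predn_half -subn1 subn_gt0 prime_gt1. Qed.

(** Carries a sign computed in ['F_p] over to [K]; it is unambiguous because 1 and -1 differ in
    ['F_p]. *)
Lemma legendre_natX d i : d ^+ m = (-1) ^+ i -> chi d = (-1) ^+ i.
Proof.
rewrite /legendre card_Fp // => dm.
have d0 : d != 0.
  apply/negP => /eqP d0; move: dm => /eqP; rewrite d0 expr0n.
  by rewrite gtn_eqF ?predn_half_gt0 // eq_sym signr_eq0.
rewrite (negbTE d0) dm -signr_odd -[(-1)^+i in RHS]signr_odd.
by case: odd; rewrite ?expr1 ?expr0 ?eqxx // eq_sym oneN1.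
Qed.

Lemma pnatr0 : p%:R = 0 :> 'F_p.
Proof. by apply: (pcharf0 (pchar_Fp p_pr)). Qed.

Lemma gauss_sqr : gauss ^+ 2 = (-1) ^+ m * p%:R.
Proof.
have two0 : 2%:R != 0 :> 'F_p by apply: two_neq0.
(* The second factor is chi(-1) times [gauss]. With y = x + w the exponent x^2 - y^2 is linear in x,
   so only w = 0 survives summation over x. *)
have : gauss * (\sum_x echar (-1 * x ^+ 2)) = p%:R.
  rewrite /gauss mulr_suml.
  under eq_bigr => x _.
    rewrite mulr_sumr (reindex_inj (addrI x)) /=.
    under eq_bigr => w _.
      rewrite -echarD (_ : _ + _ = -1 * w ^+ 2 + 2%:R * - w * x); last first.
        by ring.
    over.
  over.
  rewrite exchange_big (bigD1 0) //= [X in _ + X]big1 ?addr0 => [|w w0].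
    under eq_bigr do rewrite expr0n !mulr0 oppr0 mulr0 mul0r addr0 echar0.
    by rewrite sumr_const card_Fp.
  under eq_bigr do rewrite echarD.
  by rewrite -mulr_sumr sum_echar_lin ?mulr0 // mulf_neq0 ?oppr_eq0.
rewrite gauss_twist ?oppr_eq0 ?oner_eq0 // (@legendre_natX _ m) // => <-.
by rewrite [gauss * _]mulrCA [RHS]mulrA -exprMn mulrNN mulr1 expr1n mul1r expr2.
Qed.
End GaussSum.

(** * The sign of the quadratic Gauss sum *)

(** Used to pair k with p - k, where p = 2m + 1. *)
Lemma prod_fold (R : comNzRingType) (m : nat) (f : nat -> R) :
  \prod_(k < m.*2) f k.+1 = \prod_(k < m) (f k.+1 * f (m.*2.+1 - k.+1)%N).
Proof.
rewrite -addnn big_split_ord big_split; congr (_ * _).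
rewrite (reindex_inj rev_ord_inj); apply: eq_bigr => i _ /=.
by rewrite addnBA // -subSn // ltn_addr.
Qed.

(** * The operator X d/dX and orders of vanishing at 1 *)

Section EulerOperator.
Variable R : comNzRingType.
Implicit Types f g h : {poly R}.

(** X d/dX is diagonal on monomials, with eigenvalue n at X^n, so k iterations weight each exponent
    by its k-th power. *)
Definition euler_op f := 'X * f^`().

Lemma iter_eulerD k f g :
  iter k euler_op (f + g) = iter k euler_op f + iter k euler_op g.
Proof. by elim: k => //= k ->; rewrite /euler_op derivD mulrDr. Qed.

Lemma iter_eulerZ k c f : iter k euler_op (c *: f) = c *: iter k euler_op f.
Proof. by elim: k => //= k ->; rewrite /euler_op derivZ scalerAr. Qed.

Lemma iter_eulerXn k n : iter k euler_op 'X^n = n%:R ^+ k *: 'X^n.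
Proof.
elim: k => [|k IH]; first by rewrite scale1r.
rewrite /= IH /euler_op derivZ derivXn -scalerAr exprSr -scalerA; congr (_ *: _).
by case: n {IH} => [|n]; rewrite ?mulr0n ?mulr0 ?scale0r // mulrnAr -exprS scaler_nat.
Qed.

Lemma iter_euler_sumXn k n (e : 'I_n -> nat) :
  iter k euler_op (\sum_i 'X^(e i)) = \sum_i (e i)%:R ^+ k *: 'X^(e i).
Proof.
rewrite (big_morph _ (iter_eulerD k) (_ : _ = 0)); last first.
  by elim: k => //= k ->; rewrite /euler_op deriv0 mulr0.
by apply: eq_bigr => i _; rewrite iter_eulerXn.
Qed.

(** Each application lowers the order of vanishing at 1 by one and brings out the current
    multiplicity as a factor. *)
Lemma iter_euler_root1 k h :
  (iter k euler_op (('X - 1) ^+ k * h)).[1] = k`!%:R * h.[1].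
Proof.
elim: k h => [|k IH] h; first by rewrite expr0 !mul1r.
rewrite iterSr.
have -> : euler_op (('X - 1) ^+ k.+1 * h) =
    ('X - 1) ^+ k * ('X * (h *+ k.+1 + ('X - 1) * h^`())).
  rewrite /euler_op derivM deriv_exp derivB derivX derivE subr0 /= exprS.
  by rewrite mul1r mulrnAl -mulrnAr (mulrC ('X - 1)) -mulrA -mulrDr mulrCA.
rewrite IH hornerM hornerX mul1r hornerD hornerMn hornerM !hornerE subrr mul0r addr0.
by rewrite factS natrM -mulrA [RHS]mulrCA -[h.[1] *+ _]mulr_natl.
Qed.
End EulerOperator.

(** * Polynomial lifts of the Gauss sum and of its product form *)

Section GaussSign.
Variable p : nat.
Hypotheses (p_pr : prime p) (p_odd : odd p).
Local Notation m := (p.-1./2).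

Definition gauss_poly (R : nzRingType) : {poly R} := \sum_(j < p) 'X^(j ^ 2).

(** As 2m = -1 mod p, a factor at a p-th root of unity z is z^(k/2) - z^(-k/2) with 1/2 taken mod p;
    natural exponents make it a polynomial. *)
Definition gauss_prod_poly (R : nzRingType) : {poly R} :=
  \prod_(k < m) ('X^(m * k.+1) * ('X^(k.+1) - 1)).

Lemma predn_half_leq : (m <= p)%N.
Proof.
apply: leq_trans (leq_pred p).
by rewrite -[leqRHS](double_predn_half p_pr p_odd) -addnn leq_addr.
Qed.

Lemma map_gauss_poly (R S : nzRingType) (f : {rmorphism R -> S}) :
  map_poly f (gauss_poly R) = gauss_poly S.
Proof. by rewrite rmorph_sum; apply: eq_bigr => j _; rewrite /= map_polyXn. Qed.

Lemma map_gauss_prod_poly (R S : comNzRingType) (f : {rmorphism R -> S}) :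
  map_poly f (gauss_prod_poly R) = gauss_prod_poly S.
Proof.
rewrite rmorph_prod; apply: eq_bigr => k _.
by rewrite rmorphM rmorphB rmorph1 /= !map_polyXn.
Qed.

Lemma sum_Fp (V : nmodType) (f : nat -> V) :
  \sum_(x : 'F_p) f x = \sum_(i < p) f i.
Proof. by rewrite -(big_mkord predT f) -[in RHS](Fp_cast p_pr) big_mkord. Qed.

Lemma horner_gauss_poly (K : fieldType) (z : K) : p.-primitive_root z ->
  (gauss_poly K).[z] = gauss p z.
Proof.
move=> zp; rewrite horner_sum /gauss -(sum_Fp (fun i : nat => ('X^(i ^ 2)).[z])).
apply: eq_bigr => x _.
by rewrite hornerXn -(echar_nat p_pr zp) natrX natr_Fp.
Qed.

Lemma horner_gauss_prod_poly (K : fieldType) (z : K) :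
  (gauss_prod_poly K).[z] = \prod_(k < m) (z ^+ (m * k.+1) * (z ^+ k.+1 - 1)).
Proof. by rewrite horner_prod; apply: eq_bigr => k _; rewrite !hornerE. Qed.

(** Cancelling X - 1 in the factorisation of X^p - 1 leaves 1 + X + ... + X^(p-1), whose value at 1
    is p. *)
Lemma prod_one_sub_prim_root (K : fieldType) (z : K) : p.-primitive_root z ->
  \prod_(k < m.*2) (1 - z ^+ k.+1) = p%:R.
Proof.
move=> zp; have := factor_Xn_sub_1 zp.
rewrite double_predn_half // big_mkord -(prednK (prime_gt0 p_pr)) big_ord_recl.
rewrite expr0 subrX1 => /(mulfI (monic_neq0 (monicXsubC 1))).
move/(congr1 (fun f => f.[1])); rewrite horner_prod horner_sum.
under eq_bigr do rewrite !hornerE.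
move=> ->; under eq_bigr do rewrite hornerXn expr1n.
by rewrite sumr_const card_ord.
Qed.

(** With u = z^k and v = z^(p-k), so that uv = 1, a squared factor is v (u - 1)^2 = -(1 - u)(1 - v);
    the pairs assemble into the product of all 1 - z^k, which is p. *)
Lemma gauss_prod_sqr (K : fieldType) (z : K) : p.-primitive_root z ->
  (\prod_(k < m) (z ^+ (m * k.+1) * (z ^+ k.+1 - 1))) ^+ 2 = (-1) ^+ m * p%:R.
Proof.
move=> zp; rewrite -(prod_one_sub_prim_root zp).
rewrite (prod_fold m (fun k => 1 - z ^+ k)) -prodrXl -[X in _ ^+ X * _]card_ord -prodr_const.
rewrite -big_split; apply: eq_bigr => k _ /=.
rewrite double_predn_half // prednK ?prime_gt0 //.
have kp : (k.+1 <= p)%N.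
  by rewrite (leq_trans (ltn_ord k)) ?predn_half_leq.
have A i : (i < p)%N -> (p.-1 * i.+1 = p * i + (p - i.+1))%N.
  by move=> ip; rewrite -subn1 mulnBl mul1n mulnS [(p + _)%N]addnC addnBA.
have E : z ^+ (m * k.+1) ^+ 2 = z ^+ (p - k.+1).
  rewrite -exprM mulnAC muln2 double_predn_half // A //.
  by rewrite exprD exprM (prim_expr_order zp) expr1n mul1r.
have E2 : z ^+ k.+1 * z ^+ (p - k.+1) = 1.
  by rewrite -exprD subnKC // (prim_expr_order zp).
rewrite exprMn E; set u := z ^+ k.+1 in E2 *; set v := z ^+ (p - _) in E2 *.
transitivity ((u * v) * u - (u * v) *+ 2 + v); first by ring.
by transitivity (u - 1 - u * v + v); [rewrite E2; ring | ring].
Qed.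

(** Wilson's theorem, the two halves of (p - 1)! being matched by p - k = -k. *)
Lemma fact_half_sqr : (m`!%:R ^+ 2 * (-1) ^+ m : 'F_p) = -1.
Proof.
have W : (p.-1)`!%:R = -1 :> 'F_p.
  apply/eqP; rewrite -subr_eq0 opprK -mulrSr -(dvdn_pcharf (pchar_Fp p_pr)).
  by rewrite -Wilson // prime_gt1.
have E : \prod_(k < p.-1) (k.+1)%:R = \prod_(k < m.*2) (k.+1)%:R :> 'F_p.
  by rewrite double_predn_half.
rewrite -[RHS]W !fact_prod !big_add1 !big_mkord /= !natr_prod E (prod_fold m (fun k => k%:R)).
rewrite -prodrXl -[X in _ * _ ^+ X](card_ord m) -prodr_const -big_split.
apply: eq_bigr => k _ /=.
rewrite double_predn_half // prednK ?prime_gt0 // natrB.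
  by rewrite pnatr0 // mulrN1 sub0r mulrN expr2.
by rewrite (leq_trans (ltn_ord k)) ?predn_half_leq.
Qed.

Lemma mul_Cyclotomic_prime : ('X - 1) * 'Phi_p = 'X^p - 1.
Proof.
have P1 : 'Phi_1 = 'X - 1 by have := prod_Cyclotomic (ltn0Sn 0); rewrite /= big_seq1.
rewrite -P1 -(prod_Cyclotomic (prime_gt0 p_pr)) (perm_big [:: 1%N; p]).
  by rewrite !big_cons big_nil /= mulr1.
apply: uniq_perm => [||d]; rewrite ?divisors_uniq //=.
  by rewrite inE andbT neq_ltn prime_gt1.
rewrite -dvdn_divisors ?prime_gt0 // !inE; apply/idP/idP; first exact: (primeP p_pr).2.
by case/orP => /eqP ->; rewrite ?dvd1n.
Qed.

Lemma map_mul_Cyclotomic_prime (R : comNzRingType) :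
  ('X - 1) * map_poly intr 'Phi_p = 'X^p - 1 :> {poly R}.
Proof.
have := congr1 (map_poly (intr : int -> R)) mul_Cyclotomic_prime.
by rewrite rmorphM !rmorphB !rmorph1 /= map_polyX map_polyXn.
Qed.

(** In characteristic p, X^p - 1 = (X - 1)^p; cancel one factor X - 1. *)
Lemma Cyclotomic_prime_mod : map_poly intr 'Phi_p = ('X - 1) ^+ p.-1 :> {poly 'F_p}.
Proof.
have X1 : 'X - 1 != 0 :> {poly 'F_p} by rewrite monic_neq0 // monicXsubC.
apply: (mulfI X1); rewrite map_mul_Cyclotomic_prime -exprS prednK ?prime_gt0 //.
have pX : [pchar {poly 'F_p}].-nat p.
  by rewrite pnatE // (pchar_poly 'F_p) pchar_Fp.
have := exprDn_pchar ('X - 1 : {poly 'F_p}) 1 pX.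
by rewrite subrK expr1n => ->; rewrite addrK.
Qed.

Lemma horner_Cyclotomic_prime (K : fieldType) (z : K) : p.-primitive_root z ->
  (map_poly intr 'Phi_p).[z] = 0.
Proof.
move=> zp; have := congr1 (fun f => f.[z]) (map_mul_Cyclotomic_prime K).
rewrite !hornerE (prim_expr_order zp) subrr => /eqP; rewrite mulf_eq0 subr_eq0.
case/orP => [/eqP z1|/eqP //]; move: (prim_order_dvd zp 1).
by rewrite expr1 z1 eqxx dvdn1 => /eqP p1; move: (prime_gt1 p_pr); rewrite p1.
Qed.

End GaussSign.

(** * Fixing the sign of the product formula *)

Section GaussSignTheorem.
Variable p : nat.
Hypotheses (p_pr : prime p) (p_odd : odd p).
Local Notation m := (p.-1./2).

(** The remainder modulo the monic ['Phi_p] also vanishes at [z], and its degree is below that of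
    the minimal polynomial of [z] over Q, so it is 0. *)
Lemma Cyclotomic_dvd_int (z : algC) (f : {poly int}) : p.-primitive_root z ->
  root (map_poly intr f) z -> exists q, f = q * 'Phi_p.
Proof.
move=> zp fz; exists (Pdiv.Ring.rdivp f 'Phi_p).
have mon := Cyclotomic_monic p.
rewrite {1}(Pdiv.RingMonic.rdivp_eq mon f).
set r := Pdiv.Ring.rmodp _ _; suff -> : r = 0 by rewrite addr0.
have szr : (size r < size 'Phi_p)%N by apply: Pdiv.Ring.ltn_rmodpN0; apply: monic_neq0.
have Phiz : root (map_poly intr 'Phi_p) z.
  by rewrite (Cintr_Cyclotomic zp) root_cyclotomic.
have rz : root (map_poly (intr : int -> algC) r) z.
  move: fz; rewrite {1}(Pdiv.RingMonic.rdivp_eq mon f) rmorphD rmorphM /= !rootE.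
  by rewrite !hornerE (eqP Phiz) mulr0 add0r.
have [q [Eq _] qP] := minCpolyP z.
have ratr_int (g : {poly int}) :
    map_poly (ratr : rat -> algC) (map_poly intr g) = map_poly intr g.
  by rewrite -map_poly_comp; apply: eq_map_poly => i /=; rewrite ratr_int.
have szq : size q = size 'Phi_p.
  rewrite -(size_map_poly (ratr : {rmorphism rat -> algC})) -Eq (minCpoly_cyclotomic zp).
  by rewrite -(Cintr_Cyclotomic zp) size_map_inj_poly //; apply: intr_inj.
apply/eqP; apply: contraLR szr => r0; rewrite -leqNgt -szq.
have -> : size r = size (map_poly (intr : int -> rat) r).
  by rewrite size_map_inj_poly //; apply: intr_inj.
apply: dvdp_leq; last by rewrite -qP ratr_int.
by rewrite -size_poly_eq0 size_map_inj_poly ?size_poly_eq0 //; apply: intr_inj.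
Qed.

(* Up to sign this holds in algC because both sides have square (-1)^m p. The
   resulting congruence modulo Phi_p in Z[X], read modulo p where
   Phi_p = (X - 1)^(p - 1), fixes the sign: apply (X d/dX)^m and evaluate at 1. *)
Lemma gauss_prod (K : fieldType) (z : K) : p.-primitive_root z ->
  gauss p z = (-1) ^+ m * \prod_(k < m) (z ^+ (m * k.+1) * (z ^+ k.+1 - 1)).
Proof.
move=> zp; have [y yp] := C_prim_root_exists (prime_gt0 p_pr).
have [b Eb] : exists b : bool,
    (gauss_poly p algC).[y] = (-1) ^+ b * (gauss_prod_poly p algC).[y].
  rewrite horner_gauss_poly // horner_gauss_prod_poly.
  have /eqP := gauss_prod_sqr p_pr p_odd yp; rewrite -(gauss_sqr p_pr p_odd yp).
  rewrite eqf_sqr => /orP[]/eqP ->; first by exists false; rewrite mul1r.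
  by exists true; rewrite mulrN mulN1r opprK.
have [q Eq] : exists q, gauss_poly p int - (-1) ^+ b *: gauss_prod_poly p int = q * 'Phi_p.
  apply: (Cyclotomic_dvd_int yp); rewrite rmorphB /= map_polyZ /=.
  by rewrite map_gauss_poly map_gauss_prod_poly rmorph_sign rootE !hornerE Eb subrr.
have bm : b = odd m.
  have := congr1 (map_poly (intr : int -> 'F_p)) Eq.
  rewrite rmorphB rmorphM /= map_polyZ /= map_gauss_poly map_gauss_prod_poly rmorph_sign.
  rewrite (Cyclotomic_prime_mod p_pr) -[X in ('X - 1) ^+ X]double_predn_half // -addnn.
  rewrite exprD mulrC -mulrA.
  move/(congr1 (fun f => (iter m (@euler_op 'F_p) f).[1])) => /=.
  rewrite (@iter_euler_root1 'F_p) -scaleNr iter_eulerD iter_eulerZ iter_euler_sumXn.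
  (* Writing X^k - 1 = (X - 1)(1 + ... + X^(k-1)) exhibits the factor (X - 1)^m, with a cofactor of
     value m! at 1. *)
  rewrite [gauss_prod_poly _ _](_ : _ = ('X - 1) ^+ m *
      \prod_(k < m) ('X^(m * k.+1) * \sum_(i < k.+1) 'X^i)); last first.
    rewrite -[X in _ ^+ X]card_ord -prodr_const -big_split; apply: eq_bigr => k _ /=.
    by rewrite subrX1 mulrCA.
  rewrite hornerD hornerZ (@iter_euler_root1 'F_p).
  (* The multiple of ['Phi_p] contains (X - 1)^(2m), so m applications of the operator still leave 0
     at 1. *)
  have -> : (('X - 1) ^+ m * map_poly intr q).[1] = 0 :> 'F_p.
    rewrite hornerM horner_exp hornerD hornerN hornerX hornerC subrr expr0n.
    by rewrite (gtn_eqF (predn_half_gt0 p_pr p_odd)) mul0r.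
  rewrite mulr0.
  rewrite horner_sum horner_prod.
  have -> : \prod_(k < m) ('X^(m * k.+1) * \sum_(i < k.+1) 'X^i : {poly 'F_p}).[1] = m`!%:R.
    rewrite fact_prod big_add1 big_mkord natr_prod; apply: eq_bigr => k _.
    rewrite !hornerE expr1n mul1r horner_sum.
    by under eq_bigr do rewrite hornerXn expr1n; rewrite sumr_const card_ord.
  (* The weight of X^(j^2) is j^(2m) = j^(p-1), which is 1 for each of the p - 1 nonzero residues
     j. *)
  have -> : \sum_(i < p) ((i ^ 2)%:R ^+ m *: 'X^(i ^ 2) : {poly 'F_p}).[1] = -1.
    under eq_bigr do rewrite hornerZ hornerXn expr1n mulr1 natrX -exprM mul2n double_predn_half //.
    rewrite -(sum_Fp p_pr (fun i => i%:R ^+ p.-1)).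
    rewrite (bigD1 0) //= expr0n gtn_eqF ?add0r; last first.
      by rewrite -double_predn_half // double_gt0 predn_half_gt0.
    rewrite (eq_bigr (fun=> 1)) => [|x x0]; last first.
      by have := expf_pred_card x0; rewrite card_Fp // natr_Fp.
    rewrite sumr_const (eq_card (B := predC1 0)) // cardC1 card_Fp //.
    by rewrite -subn1 natrB ?prime_gt0 // pnatr0 // add0r.
  have := fact_half_sqr p_pr p_odd; rewrite expr2 => W.
  rewrite mulNr => /eqP; rewrite subr_eq0 => /eqP/(congr1 (fun u => u * (-1) ^+ m)) /=.
  rewrite -[RHS]mulrA W mulN1r mulrN1 => /oppr_inj /eqP.
  have N1 := @oneN1 'F_p _; rewrite card_Fp // in N1.
  rewrite -(signr_odd _ m).
  by case: (b); case: odd => //; rewrite ?expr1 ?expr0 ?[-1 == _]eq_sym N1.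
rewrite -horner_gauss_poly // -horner_gauss_prod_poly.
(* The identity in Z[X] specialises to every field with a primitive p-th root of unity, so the sign
   found through [algC] is valid in [K]. *)
have := congr1 (map_poly (intr : int -> K)) Eq.
rewrite rmorphB rmorphM /= map_polyZ /= map_gauss_poly map_gauss_prod_poly rmorph_sign.
move/(congr1 (fun f => f.[z])); rewrite !hornerE.
rewrite (horner_Cyclotomic_prime p_pr zp).
by rewrite mulr0 bm signr_odd => /eqP; rewrite subr_eq0 => /eqP.
Qed.

End GaussSignTheorem.

(** * The complex value of the prime Gauss sum *)

Section GaussValue.
Variable R : realType.

Definition cis (x : R) : R[i] := Complex (cos x) (sin x).

Lemma cisD x y : cis (x + y) = cis x * cis y.
Proof. by rewrite /cis cosD sinD; congr Complex; rewrite addrC. Qed.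

Lemma cis0 : cis 0 = 1. Proof. by rewrite /cis cos0 sin0. Qed.

Lemma cisX x n : cis x ^+ n = cis (n%:R * x).
Proof.
elim: n => [|n IH]; first by rewrite mul0r cis0.
by rewrite exprS IH -cisD mulrSr mulrDl mul1r addrC.
Qed.

Lemma cis_pi : cis pi = -1.
Proof. by rewrite /cis cospi sinpi; apply/eqP; rewrite eq_complex /= oppr0 !eqxx. Qed.

Variable p : nat.
Hypotheses (p_pr : prime p) (p_odd : odd p).
Local Notation m := (p.-1./2).

Definition zeta : R[i] := cis (2 * pi / p%:R).
Definition zeta_half : R[i] := cis (pi / p%:R).

Let p_neq0 : p%:R != 0 :> R.
Proof. by rewrite pnatr_eq0 -lt0n prime_gt0. Qed.

Lemma zeta_half_sqr : zeta_half ^+ 2 = zeta.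
Proof. by rewrite cisX mulrA. Qed.

Lemma zeta_half_exp : zeta_half ^+ p = -1.
Proof. by rewrite cisX mulrCA mulfV // mulr1 cis_pi. Qed.

Lemma sin_frac_gt0 k : (k < p.-1)%N -> 0 < sin (k.+1%:R * (pi / p%:R) : R).
Proof.
move=> kp; have p_gt0 : 0 < p%:R :> R by rewrite ltr0n prime_gt0.
apply: sin_gt0_pi; apply/andP; split.
  by apply: mulr_gt0; [rewrite ltr0n | apply: divr_gt0 => //; apply: pi_gt0].
rewrite mulrCA gtr_pMr ?pi_gt0 // ltr_pdivrMr // mul1r ltr_nat.
by rewrite -ltnS prednK ?prime_gt0 // in kp.
Qed.

Lemma zeta_prim_root : p.-primitive_root zeta.
Proof.
have zp : zeta ^+ p = 1.
  by rewrite -zeta_half_sqr -exprM mulnC exprM zeta_half_exp sqrrN expr1n.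
have [k kz] := prim_order_exists (prime_gt0 p_pr) zp.
move/(primeP p_pr).2 => /orP[]/eqP k1; last by rewrite -k1.
(* Order 1 would give zeta = 1, but the imaginary part sin(2 pi / p) is positive because p > 2. *)
have := prim_expr_order kz; rewrite k1 expr1 -zeta_half_sqr cisX => /eqP.
rewrite eq_complex /= => /andP[_]; rewrite gt_eqF // sin_frac_gt0 //.
by have := odd_prime_gt2 p_odd p_pr; case: (p) => [|[|[|]]].
Qed.

(** Put w = [zeta_half]. Since w^(2m+1) = w^p = -1, zeta^(mk) equals (-1)^k w^(-k), and w^k - w^(-k)
    = 2 i sin(k pi / p). *)
Lemma gauss_prod_factor k : (k < m)%N ->
  zeta ^+ (m * k.+1) * (zeta ^+ k.+1 - 1) =
  (-1) ^+ k.+1 * Complex 0 1 * (2 * sin (k.+1%:R * (pi / p%:R)))%:C%C.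
Proof.
move=> km; rewrite -zeta_half_sqr -!exprM !(mulnC 2).
set w := zeta_half.
have E : w ^+ (m * k.+1 * 2) * w ^+ k.+1 = (-1) ^+ k.+1.
  rewrite -exprD mulnAC muln2 double_predn_half // -mulSnr prednK ?prime_gt0 //.
  by rewrite exprM zeta_half_exp.
have w0 : w != 0.
  apply/eqP => w0; have /eqP := zeta_half_exp; rewrite -/w w0 expr0n.
  by rewrite gtn_eqF ?prime_gt0 // eq_sym oppr_eq0 oner_eq0.
have -> : w ^+ (m * k.+1 * 2) = (-1) ^+ k.+1 * w ^- k.+1.
  by rewrite -E mulfK // expf_neq0.
rewrite muln2 -addnn exprD -!mulrA; congr (_ * _).
rewrite mulrBr mulr1 mulKf ?expf_neq0 //.
have -> : w ^- k.+1 = cis (- (k.+1%:R * (pi / p%:R))).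
  apply: (mulfI (expf_neq0 k.+1 w0)); rewrite mulfV ?expf_neq0 //.
  by rewrite cisX -cisD subrr cis0.
rewrite cisX /cis cosN sinN.
by apply/eqP; rewrite eq_complex /=; apply/andP; split; apply/eqP; ring.
Qed.

Lemma gauss_zeta :
  gauss p zeta = (Num.sqrt p%:R)%:C%C * (if odd m then Complex 0 1 else 1).
Proof.
pose r := \prod_(k < m) (2 * sin (k.+1%:R * (pi / p%:R)) : R).
have i2 : Complex 0 1 * Complex 0 1 = -1 :> R[i].
  by apply/eqP; rewrite eq_complex /=; apply/andP; split; apply/eqP; ring.
(* Induction by steps of two: the two new factors have opposite signs, so they multiply to -(i^2) =
   1. *)
have u n : (-1) ^+ n * \prod_(k < n) ((-1) ^+ k.+1 * Complex 0 1) =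
    if odd n then Complex 0 1 else 1 :> R[i].
  elim/ltn_ind: n => -[|[|n]] IH; first by rewrite big_ord0 mulr1.
    by rewrite big_ord_recr big_ord0 /= !expr1 mul1r mulrA mulrNN !mul1r.
  rewrite /= negbK -IH // !big_ord_recr /= !exprS !mulN1r !opprK.
  set P := \prod_(_ < _) _; set s := _ ^+ n; rewrite -[RHS]mulr1.
  have ss : s * s = 1 by rewrite -exprMn mulrNN mulr1 expr1n.
  transitivity (- (s * P) * (s * s) * (Complex 0 1 * Complex 0 1)); first by ring.
  by rewrite ss i2 mulrN1 mulr1 opprK mulr1.
have G : gauss p zeta = r%:C%C * (if odd m then Complex 0 1 else 1).
  rewrite (gauss_prod p_pr p_odd zeta_prim_root) -u mulrCA /r rmorph_prod -big_split /=.
  congr (_ * _); apply: eq_bigr => k _.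
  by rewrite gauss_prod_factor // mulrC.
(* Each angle k pi / p lies strictly between 0 and pi. Positivity and [gauss_sqr] then identify [r]
   as the square root of p. *)
have r_gt0 : 0 < r.
  apply: prodr_gt0 => k _; rewrite mulr_gt0 // sin_frac_gt0 //.
  rewrite (leq_trans (ltn_ord k)) // -[leqRHS](double_predn_half p_pr p_odd).
  by rewrite -addnn leq_addr.
suff -> : Num.sqrt p%:R = r by [].
have : (r ^+ 2)%:C%C = (p%:R : R)%:C%C.
  have := gauss_sqr p_pr p_odd zeta_prim_root.
  rewrite G exprMn -signr_odd rmorphXn rmorph_nat.
  have -> : (if odd m then Complex 0 1 else 1) ^+ 2 = (-1) ^+ odd m :> R[i].
    by case: ifP; rewrite ?expr1n // expr2 i2.
  by rewrite mulrC => /mulfI ->; rewrite ?signr_eq0.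
by move/complexI => <-; rewrite sqrtr_sqr ger0_norm // ltW.
Qed.
End GaussValue.

(** * Gauss sums of symmetric matrices *)

Section GaussMatrix.
Variables (p : nat) (K : fieldType) (z : K).
Hypotheses (p_pr : prime p) (p_odd : odd p) (z_prim : p.-primitive_root z).
Local Notation chi := (@legendre 'F_p K).
Local Notation qform S v := ((v *m S *m v^T) 0 0).

Let oddFp : odd #|'F_p|. Proof. by rewrite card_Fp. Qed.

Definition gauss_mx n (S : 'M['F_p]_n) : K :=
  \sum_(v : 'rV_n) echar z (qform S v).

Lemma legendre1 : chi 1 = 1.
Proof. by rewrite /legendre oner_eq0 expr1n eqxx. Qed.

Lemma gauss_mx_congr n (P S : 'M['F_p]_n) : P \in unitmx ->
  gauss_mx (P *m S *m P^T) = gauss_mx S.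
Proof.
move=> Pu; rewrite [RHS](reindex (fun v : 'rV_n => v *m P)) /=; last first.
  by exists (fun v => v *m invmx P) => v _; rewrite ?mulmxK ?mulmxKV.
by apply: eq_bigr => v _; rewrite trmx_mul !mulmxA.
Qed.

(** If S 0 0 = 0, some S 0 j is nonzero. Adding c times row and column j to row and column 0 gives
    the corner c (2 S 0 j + c S j j); if c = 1 fails, then S j j = -2 S 0 j and c = -1 gives -4 S 0
    j. *)
Lemma pivot_mx n (S : 'M['F_p]_n.+1) : S^T = S -> \det S != 0 ->
  exists2 P, P \in unitmx & (P *m S *m P^T) 0 0 != 0.
Proof.
move=> symS dS; have [S00|S00] := eqVneq (S 0 0) 0; last first.
  by exists 1%:M; rewrite ?unitmx1 // trmx1 mulmx1 mul1mx.
have [j Sj] : exists j, S 0 j != 0.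
  apply/existsP; apply: contraNT dS => /existsPn S0.
  rewrite (expand_det_row _ 0) big1 // => j _.
  by have := S0 j; rewrite negbK => /eqP ->; rewrite mul0r.
have j0 : (j == 0) = false by apply: contraNF Sj => /eqP ->; rewrite S00.
pose P c : 'M['F_p]_n.+1 := 1%:M + c *: delta_mx 0 j.
have Pu c : P c \in unitmx.
  have : P c *m P (- c) = 1%:M.
    rewrite /P mulmxDl mul1mx mulmxDr mulmx1 -scalemxAl -scalemxAr mul_delta_mx_cond j0.
    by rewrite mulr0n !scaler0 addr0 scaleNr subrK.
  by move/mulmx1_unit => [].
have E c : (P c *m S *m (P c)^T) 0 0 = c * (2%:R * S 0 j + c * S j j).
  have R0 v : (P c *m v) 0 0 = v 0 0 + c * v j 0 :> 'F_p.
    rewrite /P mulmxDl mul1mx -scalemxAl mxE [in X in _ + X]mxE; congr (_ + _ * _).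
    rewrite mxE (bigD1 j) //= big1 ?addr0 => [|i ij]; first by rewrite mxE !eqxx mul1r.
    by rewrite mxE (negbTE ij) andbF mul0r.
  have C0 i : (S *m (P c)^T) i 0 = S i 0 + c * S i j.
    rewrite /P linearD linearZ /= trmx1 trmx_delta mulmxDr mulmx1 -scalemxAr mxE [in X in _ + X]mxE.
    congr (_ + _ * _).
    rewrite mxE (bigD1 j) //= big1 ?addr0 => [|k kj]; first by rewrite mxE !eqxx mulr1.
    by rewrite mxE (negbTE kj) mulr0.
  have Sj0 : S j 0 = S 0 j by rewrite -[in LHS]symS mxE.
  by rewrite -mulmxA R0 !C0 S00 Sj0; ring.
have S2 : 2%:R * S 0 j != 0 by rewrite mulf_neq0 ?two_neq0.
have [E1|E1] := eqVneq ((P 1 *m S *m (P 1)^T) 0 0) 0; last by exists (P 1).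
exists (P (-1)) => //; rewrite E mulf_neq0 ?oppr_eq0 ?oner_eq0 //.
have Sjj : S j j = - (2%:R * S 0 j).
  by move/eqP: E1; rewrite E !mul1r addrC addr_eq0 => /eqP.
rewrite Sjj (_ : _ + _ = 2%:R * (2%:R * S 0 j)); last by ring.
by rewrite mulf_neq0 ?two_neq0.
Qed.

Lemma schur_det n (S : 'M['F_p]_(1 + n)) : S 0 0 != 0 ->
  \det S = S 0 0 * \det (drsubmx S - (S 0 0)^-1 *: (dlsubmx S *m ursubmx S)).
Proof.
move=> a0; set a := S 0 0; set b := ursubmx S; set c := dlsubmx S.
have Eul : ulsubmx S = a%:M.
  rewrite [LHS]mx11_scalar; congr _%:M; rewrite !mxE /a; congr (S _ _); exact: val_inj.
have E : S *m block_mx 1%:M (- a^-1 *: b) 0 1%:M =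
    block_mx a%:M 0 c (drsubmx S - a^-1 *: (c *m b)).
  rewrite -{1}[S]submxK mulmx_block Eul !mulmx1 !mulmx0 !addr0.
  rewrite mul_scalar_mx scalerA mulrN mulfV // scaleN1r addNr.
  by rewrite -scalemxAr scaleNr addrC.
have := congr1 determinant E; rewrite det_mulmx det_ublock det_lblock !det1 !mulr1.
by rewrite det_scalar1.
Qed.

(** Completing the square for v = (x, y): with a = S 0 0 and beta = b y^T, the form is a (x + beta /
    a)^2 plus the Schur complement at y. *)
Lemma schur_gauss_mx n (S : 'M['F_p]_(1 + n)) : S^T = S -> S 0 0 != 0 ->
  gauss_mx S = chi (S 0 0) * gauss p z *
    gauss_mx (drsubmx S - (S 0 0)^-1 *: (dlsubmx S *m ursubmx S)).
Proof.
move=> symS a0; set a := S 0 0 in a0 *; set b := ursubmx S; set c := dlsubmx S.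
have Eul : ulsubmx S = a%:M.
  rewrite [LHS]mx11_scalar; congr _%:M; rewrite !mxE /a; congr (S _ _); exact: val_inj.
have Ec : c = b^T by rewrite /b trmx_ursub symS.
rewrite -(gauss_twist p_pr p_odd z_prim a0) mulr_suml.
rewrite /gauss_mx (reindex (fun u : 'F_p * 'rV_n => row_mx u.1%:M u.2)) /=; last first.
  exists (fun v : 'rV_(1 + n) => (lsubmx v 0 0, rsubmx v)) => [[x y]|v] _ /=.
    by rewrite row_mxKl row_mxKr mxE eqxx mulr1n.
  by rewrite -mx11_scalar hsubmxK.
rewrite -(pair_bigA _ (fun x y => echar z (qform S (row_mx x%:M y)))) /=.
under [RHS]eq_bigr do rewrite mulr_sumr.
rewrite exchange_big [RHS]exchange_big; apply: eq_bigr => y _ /=.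
pose beta := (b *m y^T) 0 0.
rewrite [RHS](reindex_inj (addIr (a^-1 * beta))) /=; apply: eq_bigr => x _.
rewrite -(echarD p_pr z_prim); congr echar.
rewrite -{1}[S]submxK -/b -/c Eul mul_row_block tr_row_mx mul_row_col tr_scalar_mx.
rewrite !mul_mx_scalar !mul_scalar_mx mulmxBr mulmxBl !mulmxDl -!scalemxAl -!scalemxAr -!scalemxAl.
rewrite Ec !mulmxA -[y *m b^T *m b *m _]mulmxA.
have yb : (y *m b^T) 0 0 = beta.
  by have := congr1 (fun A : 'M_1 => A 0 0) (trmx_mul b y^T); rewrite trmxK mxE.
set M := y *m drsubmx S *m _.
have Eb : b *m y^T = beta%:M by rewrite [LHS]mx11_scalar.
have Eb2 : y *m b^T = beta%:M by rewrite [LHS]mx11_scalar yb.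
rewrite Eb Eb2 mul_scalar_mx !mxE eqxx !mulr1n.
by rewrite sqrrD; field.
Qed.

(** Induction on the size: a congruence makes the corner nonzero and changes the determinant by a
    square, then one variable splits off. *)
Lemma gauss_mxE n (S : 'M['F_p]_n) : S^T = S -> \det S != 0 ->
  gauss_mx S = chi (\det S) * gauss p z ^+ n.
Proof.
elim: n S => [|n IH] S symS dS.
  rewrite det_mx00 legendre1 mulr1 /gauss_mx (bigD1 0) //= big1 => [|v]; last first.
    by rewrite [v]thinmx0 eqxx.
  by rewrite mul0mx mul0mx mxE addr0.
have [P Pu P00] := pivot_mx symS dS.
rewrite -(gauss_mx_congr S Pu).
set T := P *m S *m P^T in P00 *.
have symT : T^T = T by rewrite /T !trmx_mul trmxK symS mulmxA.
have dT : \det T = \det S * (\det P) ^+ 2 by rewrite /T !det_mulmx det_tr; ring.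
have dP : \det P != 0 by rewrite -unitfE -unitmxE.
have dT0 : \det T != 0 by rewrite dT mulf_neq0 ?expf_neq0.
have chiT : chi (\det T) = chi (\det S).
  by rewrite dT expr2 !legendreM // legendre_sqr // mulr1.
rewrite (schur_gauss_mx symT P00) -chiT schur_det // legendreM //.
rewrite schur_det // mulf_eq0 negb_or in dT0; case/andP: dT0 => _ d2.
rewrite IH // ?exprS; first by ring.
rewrite linearB /= linearZ /= trmx_mul trmx_drsub symT trmx_dlsub trmx_ursub symT.
by [].
Qed.
End GaussMatrix.

(** * Subfields and traces *)

(* The unused proof argument lets unification find the ring morphism structure. *)
Definition Fp_embed (F : fieldType) (p : nat) of p \in [pchar F] :=
  fun k : 'F_p => (k : nat)%:R : F.

Section PrimeField.
Variables (F : fieldType) (p : nat).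
Hypothesis charF : p \in [pchar F].
Local Notation iota := (Fp_embed charF).

Let p_pr : prime p := pcharf_prime charF.

Lemma Fp_embed_nat i : iota i%:R = i%:R.
Proof.
rewrite /Fp_embed val_Fp_nat // [in RHS](divn_eq i p) natrD natrM.
by rewrite (pcharf0 charF) mulr0 add0r.
Qed.

Lemma Fp_embed_zmod_morphism : zmod_morphism iota.
Proof.
have D x y : iota (x + y) = iota x + iota y.
  by rewrite -[in LHS](natr_Fp x) -[in LHS](natr_Fp y) -natrD Fp_embed_nat natrD.
by move=> x y; have := D (x - y) y; rewrite subrK => ->; rewrite addrK.
Qed.

Lemma Fp_embed_monoid_morphism : monoid_morphism iota.
Proof.
split=> [|x y]; first by rewrite -[1]/(1%:R) Fp_embed_nat.
by rewrite -[in LHS](natr_Fp x) -[in LHS](natr_Fp y) -natrM Fp_embed_nat natrM.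
Qed.

HB.instance Definition _ :=
  GRing.isZmodMorphism.Build 'F_p F iota Fp_embed_zmod_morphism.
HB.instance Definition _ :=
  GRing.isMonoidMorphism.Build 'F_p F iota Fp_embed_monoid_morphism.

Lemma Fp_embed_exp k i : iota k ^+ (p ^ i) = iota k.
Proof.
elim: i => [|i IH]; first by rewrite expr1.
rewrite expnSr exprM IH -rmorphXn /=; congr iota.
by have := expf_card k; rewrite card_Fp.
Qed.

(** X^p - X already splits over ['F_p], so all its roots in [F] come from there. *)
Lemma Fp_embedP y : y ^+ p = y -> exists k, y = iota k.
Proof.
move=> yp; have := congr1 (map_poly iota) (finField_genPoly 'F_p).
rewrite rmorphB rmorph_prod /= map_polyXn map_polyX card_Fp // => /(congr1 (fun f => f.[y])).
rewrite hornerD hornerN hornerXn hornerX yp subrr horner_prod => /esym/eqP.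
rewrite prodf_seq_eq0 => /hasP[k _ /= /eqP]; rewrite rmorphB /= map_polyX map_polyC !hornerE.
by move/eqP; rewrite subr_eq0 => /eqP ->; exists k.
Qed.

Lemma frobD i (x y : F) : (x + y) ^+ (p ^ i) = x ^+ (p ^ i) + y ^+ (p ^ i).
Proof. by apply: exprDn_pchar; rewrite pnatX pnatE // charF. Qed.

Lemma frob_sum i (I : Type) (r : seq I) (P : pred I) (f : I -> F) :
  (\sum_(j <- r | P j) f j) ^+ (p ^ i) = \sum_(j <- r | P j) f j ^+ (p ^ i).
Proof.
by apply: (big_morph _ (frobD i)); rewrite expr0n gtn_eqF ?expn_gt0 ?prime_gt0.
Qed.
End PrimeField.

(** Raising to the power p^t shifts the summands cyclically, the last one wrapping around by x^(p^n)
    = x. *)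
Lemma trF_subF (F : finFieldType) (p n t : nat) (x : F) :
  p \in [pchar F] -> (t %| n)%N -> x ^+ (p ^ n) = x -> trF F p n t x \in subF F p t.
Proof.
move=> charF tn xn; rewrite inE; apply/eqP; rewrite /trF (frob_sum charF).
move: (divnK tn) xn; case: (n %/ t)%N => [|d] <- xn; first by rewrite !big_ord0.
rewrite big_ord_recr big_ord_recl /= muln0 expr1 addrC -exprM -expnD -mulnSr [(t * _)%N]mulnC xn.
by congr (_ + _); apply: eq_bigr => i _; rewrite -exprM -expnD -mulnSr.
Qed.

Lemma prime_repK (F : finFieldType) (p : nat) (charF : p \in [pchar F]) (k : 'F_p) :
  prime_rep F p (Fp_embed charF k) = k.
Proof.
have p_pr := pcharf_prime charF; rewrite /prime_rep; case: pickP => [i /=|].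
  rewrite -(Fp_embed_nat charF) (inj_eq (fmorph_inj _)) => /eqP <-.
  by rewrite val_Fp_nat // modn_small.
have kp : (k < p)%N by rewrite -[X in (_ < X)%N](Fp_cast p_pr).
by move/(_ (Ordinal kp)); rewrite eqxx.
Qed.

(** * The subfield of order p^t inside [F] *)

Section Subfield.
Variables (F : finFieldType) (p n t : nat).
Hypotheses (p_pr : prime p) (t_gt0 : (0 < t)%N) (tn : (t %| n)%N).
Hypothesis cardF : #|F| = (p ^ n)%N.
Hypothesis charF : p \in [pchar F].
Local Notation A := (subF F p t).
Local Notation iota := (Fp_embed charF).

Lemma subFP (x : F) : reflect (x ^+ (p ^ t) = x) (x \in A).
Proof. by rewrite inE; apply: eqP. Qed.

Lemma subF_frob i x : x \in A -> x ^+ (p ^ (t * i)) = x.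
Proof.
move/subFP => xA; elim: i => [|i IH]; first by rewrite muln0 expr1.
by rewrite mulnS expnD exprM xA IH.
Qed.

Lemma frob_card (x : F) : x ^+ (p ^ n) = x.
Proof. by rewrite -cardF expf_card. Qed.

Lemma subF_exp_pred x : x \in A -> x != 0 -> x ^+ (p ^ t).-1 = 1.
Proof.
move=> /subFP xA x0; apply: (mulfI x0).
by rewrite -exprS prednK ?expn_gt0 ?prime_gt0 // xA mulr1.
Qed.

(** Transitivity of the trace: [w] is fixed by p^t-th powers, so it passes through the inner trace,
    and exponents k < n are t l + i with i < t. *)
Lemma trF_tower (c w : F) : w \in A ->
  trF F p n 1 (c * w) = trF F p t 1 (trF F p n t c * w).
Proof.
move=> wA; rewrite /trF !divn1.
under [RHS]eq_bigr => i _.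
  rewrite mul1n mulr_suml frob_sum //.
  under eq_bigr => l _ do rewrite -{1}(subF_frob l wA) -exprMn -exprM -expnD addnC.
  over.
rewrite [RHS]exchange_big /=; under eq_bigr do rewrite mul1n.
transitivity (\sum_(k < n %/ t * t) (c * w) ^+ (p ^ k)); first by rewrite divnK.
elim: (n %/ t)%N => [|d IH]; first by rewrite !big_ord0.
rewrite mulSnr big_split_ord big_ord_recr IH /=; congr (_ + _).
by apply: eq_bigr => i _; rewrite addnC mulnC.
Qed.

Lemma dvd_pred_exp : exists d, ((p ^ n).-1 = (p ^ t).-1 * d)%N.
Proof.
rewrite -(divnK tn) mulnC expnM predn_exp; by eexists.
Qed.

(** As p^t - 1 divides p^n - 1, X^(p^t) - X divides X^q - X, a product of distinct linear factors
    over [F], and so has p^t roots there. *)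
Lemma card_subF : #|A| = (p ^ t)%N.
Proof.
have pt : (1 < p ^ t)%N by rewrite -(exp1n t) ltn_exp2r ?prime_gt1.
have pt0 := ltnW pt.
pose f : {poly F} := 'X^(p ^ t) - 'X.
have szf : size f = (p ^ t).+1.
  by rewrite /f size_polyDl ?size_polyXn // size_polyN size_polyX.
have : f %| 'X^#|F| - 'X.
  have [d Ed] := dvd_pred_exp.
  have E k : (0 < k)%N -> 'X^k - 'X = ('X^(k.-1) - 1) * 'X :> {poly F}.
    by move=> k0; rewrite mulrBl mul1r -exprSr prednK.
  rewrite /f cardF !E ?expn_gt0 ?prime_gt0 // dvdp_mul2r ?polyX_eq0 //.
  rewrite Ed (_ : 'X^(_ * d) - 1 = ('X^((p ^ t).-1)) ^+ d - 1 ^+ d :> {poly F}).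
    by rewrite subrXX dvdp_mulr.
  by rewrite exprM expr1n.
rewrite finField_genPoly => /dvdp_prod_XsubC[ms eqf].
set s := mask _ _ in eqf.
have szs : size s = (p ^ t)%N.
  by apply/eqP; rewrite -eqSS -szf (eqp_size eqf) size_prod_XsubC.
rewrite -szs -(card_uniqP _); last by rewrite mask_uniq // index_enum_uniq.
apply: eq_card => x; rewrite inE -subr_eq0.
have -> : (x ^+ (p ^ t) - x == 0) = root f x by rewrite rootE !hornerE.
by rewrite (eqp_root eqf) root_prod_XsubC.
Qed.

(** Euler's criterion within [A]. If the power is 1, [x] is a square w^2 in [F] by the criterion
    there, and w^(p^t) = w x^((p^t-1)/2) = w puts [w] in [A]. *)
Lemma subF_exp_half x : odd p -> x \in A -> x != 0 ->
  x ^+ ((p ^ t).-1./2) = if [exists w in A, w ^+ 2 == x] then 1 else -1.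
Proof.
move=> p_odd xA x0.
have oF : odd #|F| by rewrite cardF oddX p_odd orbT.
have h2 : ((p ^ t).-1./2.*2 = (p ^ t).-1)%N.
  by rewrite even_halfK // -subn1 oddB ?expn_gt0 ?prime_gt0 // oddX p_odd orbT.
have hn : ((p ^ n).-1./2.*2 = (p ^ n).-1)%N by rewrite -cardF card_pred_half.
case: ifPn => [/existsP[w /andP[wA /eqP wx]]|].
  rewrite -wx -exprM mul2n h2 subF_exp_pred //.
  by apply: contraNneq x0 => w0; rewrite -wx w0 expr0n.
move=> /existsPn nw.
have : (x ^+ (p ^ t).-1./2) ^+ 2 = 1 by rewrite -exprM muln2 h2 subF_exp_pred.
move/eqP; rewrite sqrf_eq1 => /orP[] /eqP // xh.
have [d Ed] := dvd_pred_exp.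
have : x ^+ #|F|.-1./2 == 1.
  have -> : (#|F|.-1./2 = (p ^ t).-1./2 * d)%N.
    by apply: double_inj; rewrite cardF hn doubleMl h2.
  by rewrite exprM xh expr1n.
rewrite expf_half_sqr // => /existsP[w /eqP wx].
have /negP[] := nw w; rewrite wx eqxx andbT; apply/subFP.
by rewrite -[(p ^ t)%N]prednK ?expn_gt0 ?prime_gt0 // -h2 -mul2n exprS exprM wx xh mulr1.
Qed.

(** The polynomial with these coefficients has degree at most p^(t-1), too small for p^t roots
    unless it is 0. *)
Lemma additive_poly_eq0 (w : 'I_t -> F) :
  (forall x, x \in A -> \sum_(j < t) w j * x ^+ (p ^ j) = 0) -> forall j, w j = 0.
Proof.
move=> wA j; pose f : {poly F} := \sum_(i < t) w i *: 'X^(p ^ i).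
have fj : f`_(p ^ j) = w j.
  rewrite coef_sum (bigD1 j) //= big1 ?addr0 => [|i ij].
    by rewrite coefZ coefXn eqxx mulr1.
  rewrite coefZ coefXn eqn_exp2l ?prime_gt1 // (_ : (_ == _) = false) ?mulr0 //.
  by rewrite eq_sym; apply: negbTE.
rewrite -fj; suff -> : f = 0 by rewrite coef0.
apply/eqP; apply: contraT => f0.
have : (size (enum A) < size f)%N.
  apply: max_poly_roots => //; last exact: enum_uniq.
  apply/allP => x; rewrite mem_enum => xA; rewrite rootE horner_sum.
  by under eq_bigr do rewrite hornerZ hornerXn; rewrite wA.
rewrite -cardE card_subF ltnNge; case/negP.
apply: leq_trans (size_sum _ _ _) _; apply/bigmax_leqP => i _.
apply: leq_trans (size_scale_leq _ _) _.
by rewrite size_polyXn ltn_exp2l ?prime_gt1.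
Qed.

Definition lin_comb (e : 'I_t -> F) (v : 'rV['F_p]_t) : F :=
  \sum_i iota (v 0 i) * e i.

(** [A] is an F_p-subspace of [F], of dimension t by [card_subF]. Inverse coordinate maps are the
    form needed to reindex sums over [A]. *)
Lemma subF_basis : exists e : 'I_t -> F, exists h : F -> 'rV['F_p]_t,
  [/\ cancel (lin_comb e) h, {in A, cancel h (lin_comb e)} &
      forall v, lin_comb e v \in A].
Proof.
pose L := pPrimeCharType charF.
pose sA : seq L := enum A.
pose V : {vspace L} := <<sA>>%VS.
have lcA (r : nat) (e : 'I_r -> F) (c : 'I_r -> 'F_p) :
    (forall i, e i \in A) -> \sum_i iota (c i) * e i \in A.
  move=> eA; apply/subFP; rewrite frob_sum //; apply: eq_bigr => i _.
  by rewrite exprMn Fp_embed_exp (subFP _ (eA i)).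
have VA x : (x \in V) = (x \in A).
  apply/idP/idP => [xV|xA]; last by apply: memv_span; rewrite mem_enum.
  rewrite (coord_span (X := in_tuple sA) xV); apply: lcA => i.
  by rewrite -mem_enum mem_nth.
have dV : \dim V = t.
  apply/eqP; rewrite -(eqn_exp2l _ _ (prime_gt1 p_pr)) -card_subF -[X in (X ^ _)%N](card_Fp p_pr).
  by rewrite -(card_vspace V); apply/eqP/eq_card => x; rewrite VA.
move: (vbasisP V); move: (vbasis V); rewrite dV => B Bb.
have eV (i : 'I_t) : B`_i \in V.
  by apply: (basis_mem Bb); rewrite mem_nth ?size_tuple.
exists (fun i => B`_i); exists (fun x => \row_i coord B i x).
split.
- move=> v; apply/rowP => i; rewrite mxE.
  exact: coord_sum_free (basis_free Bb).
- move=> x; rewrite -VA => xV; rewrite [RHS](coord_basis Bb xV).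
  by apply: eq_bigr => i _; rewrite mxE.
- by move=> v; apply: lcA => i; rewrite -VA.
Qed.
End Subfield.

(** * Gauss sums over subfields *)

(** The last column is nonzero only in row 0, and deleting both leaves the identity. *)
Lemma det_cyclic_shift (R : comNzRingType) t :
  \det (\matrix_(k < t.+1, j < t.+1) ((k : nat) == (j.+1 %% t.+1)%N)%:R : 'M[R]_t.+1) = (-1) ^+ t.
Proof.
rewrite (expand_det_col _ ord_max) (bigD1 ord0) //= big1 ?addr0 => [|i i0].
  rewrite mxE /= modnn eqxx mul1r /cofactor add0n.
  rewrite (_ : row' _ _ = 1%:M) ?det1 ?mulr1 //; apply/matrixP => k j.
  rewrite !mxE lift_max lift0 modn_small ?ltnS // eqSS.
by rewrite mxE modnn -[0%N]/(nat_of_ord (ord0 : 'I_t.+1)) val_eqE (negbTE i0) mul0r.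
Qed.

Definition moore_mx (F : pzRingType) (p t : nat) (e : 'I_t -> F) : 'M[F]_t :=
  \matrix_(i, j) e i ^+ (p ^ j).

(** Entrywise Frobenius amounts to right multiplication by the cyclic shift matrix, the last column
    wrapping around by e_i^(p^t) = e_i. *)
Lemma det_moore_frob (F : fieldType) (p t : nat) (e : 'I_t -> F) :
  p \in [pchar F] -> (forall i, e i ^+ (p ^ t) = e i) ->
  \det (moore_mx p e) ^+ p = (-1) ^+ t.-1 * \det (moore_mx p e).
Proof.
move=> charF; case: t e => [|t] e ep; first by rewrite !det_mx00 expr1n mulr1.
rewrite -(pFrobenius_autE charF) -det_map_mx mulrC -(det_cyclic_shift F t) -det_mulmx.
congr (\det _); apply/matrixP => i j; rewrite !mxE.
rewrite (bigD1 (Ordinal (ltn_pmod j.+1 (ltn0Sn t)))) //= big1 ?addr0 => [|k kj].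
  rewrite !mxE /= eqxx mulr1 pFrobenius_autE -exprM -expnSr.
  have := ltn_ord j; rewrite leq_eqVlt => /orP[/eqP ->|jt]; last by rewrite modn_small.
  by rewrite modnn ep expr1.
rewrite !mxE (_ : (_ == _) = false) ?mulr0 //.
by apply: contraNF kj => /eqP kj; apply/eqP/val_inj.
Qed.

Section SubfieldGauss.
Variables (F : finFieldType) (p n t : nat).
Hypotheses (p_pr : prime p) (p_odd : odd p) (t_gt0 : (0 < t)%N) (tn : (t %| n)%N).
Hypothesis cardF : #|F| = (p ^ n)%N.
Hypothesis charF : p \in [pchar F].
Local Notation A := (subF F p t).
Local Notation iota := (Fp_embed charF).
Local Notation m := (p.-1./2).

Section Basis.
Variables (e : 'I_t -> F) (h : F -> 'rV['F_p]_t).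
Hypotheses (eK : cancel (lin_comb charF e) h)
  (hK : {in A, cancel h (lin_comb charF e)})
  (eA : forall v, lin_comb charF e v \in A).

Lemma basis_subF i : e i \in A.
Proof.
rewrite (_ : e i = lin_comb charF e (delta_mx 0 i)) //.
rewrite /lin_comb (bigD1 i) //= big1 ?addr0 => [|j ji].
  by rewrite mxE !eqxx rmorph1 mul1r.
by rewrite mxE eqxx (negbTE ji) rmorph0 mul0r.
Qed.

Lemma lin_comb_moore v j :
  (map_mx iota v *m moore_mx p e) 0 j = lin_comb charF e v ^+ (p ^ j).
Proof.
rewrite mxE /lin_comb frob_sum //; apply: eq_bigr => i _.
by rewrite !mxE exprMn Fp_embed_exp.
Qed.

(** A row vector killed by the transpose gives an additive polynomial that vanishes on the basis,
    hence on all of [A]. *)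
Lemma det_moore_neq0 : \det (moore_mx p e) != 0.
Proof.
rewrite -det_tr; apply/det0P => -[w /eqP w0 wE]; apply: w0; apply/rowP => j; rewrite [RHS]mxE.
apply: (additive_poly_eq0 p_pr t_gt0 tn cardF (w := fun j => w 0 j)) => x xA.
rewrite -(hK xA).
under eq_bigr do rewrite -lin_comb_moore.
transitivity ((w *m (map_mx iota (h x) *m moore_mx p e)^T) 0 0).
  by rewrite mxE; apply: eq_bigr => i _; rewrite [in RHS]mxE.
by rewrite trmx_mul mulmxA wE mul0mx mxE.
Qed.

(** Entry (i, j) of the product is the trace of T e_i e_j, which lies in F_p; thus [S] represents
    the form Tr(T x^2). *)
Lemma trace_form_mx T : T \in A -> exists S : 'M['F_p]_t,
  map_mx iota S = moore_mx p e *m diag_mx (\row_j T ^+ (p ^ j)) *m (moore_mx p e)^T.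
Proof.
move=> TA.
have H (u : 'I_t * 'I_t) : exists k, iota k = trF F p t 1 (T * e u.1 * e u.2).
  have := @trF_subF F p t 1 (T * e u.1 * e u.2) charF (dvd1n _).
  rewrite !exprMn !(subFP _ _ _ (basis_subF _)) (subFP _ _ _ TA) => /(_ erefl).
  by rewrite inE expn1 => /eqP/(Fp_embedP charF)[k ->]; exists k.
have [f fP] := fin_all_exists H.
exists (\matrix_(i, j) f (i, j)); apply/matrixP => i j.
rewrite !mxE fP /trF divn1; apply: eq_bigr => k _.
rewrite mul_mx_diag !mxE !exprMn mul1n; ring.
Qed.
End Basis.

Lemma gauss_subF (K : fieldType) (z : K) T : p.-primitive_root z ->
  T \in A -> T != 0 ->
  \sum_(x in A) z ^+ prime_rep F p (trF F p t 1 (T * x ^+ 2)) =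
  (-1) ^+ t.-1 * (if [exists w in A, w ^+ 2 == T] then 1 else -1) * gauss p z ^+ t.
Proof.
move=> zp TA T0; have [e [h [eK hK eA]]] := subF_basis p_pr t_gt0 tn cardF charF.
have [S ES] := trace_form_mx eA TA.
set E := moore_mx p e in ES; set D := diag_mx _ in ES.
have symS : S^T = S.
  apply: (map_mx_inj (f := iota)); rewrite -matrix.map_trmx ES !trmx_mul trmxK tr_diag_mx.
  by rewrite mulmxA.
have det_iota : iota (\det S) = \det E ^+ 2 * T ^+ (\sum_(j < t) p ^ j)%N.
  rewrite -det_map_mx ES !det_mulmx det_tr det_diag (eq_bigr (fun j : 'I_t => T ^+ (p ^ j))).
    by rewrite prodrXr; ring.
  by move=> j _; rewrite mxE.
have E0 : \det E != 0 by apply: det_moore_neq0 hK.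
have dS : \det S != 0.
  by rewrite -(fmorph_eq0 iota) /= det_iota mulf_neq0 ?expf_neq0.
have m2 : (m.*2 = p.-1)%N by rewrite double_predn_half.
have chiS : legendre K (\det S) =
    (-1) ^+ t.-1 * (if [exists w in A, w ^+ 2 == T] then 1 else -1).
  set b := [exists w in A, _].
  rewrite (_ : (if b then 1 else -1) = (-1) ^+ (~~ b)); last by case: b.
  rewrite -exprD; apply: legendre_natX => //; apply: (fmorph_inj iota).
  (* The m-th power of det S is (det E)^(p-1) times T^((p^t-1)/2), because (p - 1)(1 + p + ... +
     p^(t-1)) = p^t - 1. *)
  rewrite rmorphXn /= det_iota exprMn -!exprM mul2n m2 rmorphXn rmorphN1 exprD.
  congr (_ * _).
    apply: (mulIf E0); rewrite -exprSr prednK ?prime_gt0 // (det_moore_frob charF) // => i.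
    by apply/subFP/(basis_subF eA).
  rewrite (_ : (_ * m)%N = (p ^ t).-1./2).
    by rewrite (subF_exp_half p_pr tn cardF) // -/b; case: b.
  apply: double_inj; rewrite doubleMr m2 even_halfK; first by rewrite predn_exp mulnC.
  by rewrite -subn1 oddB ?expn_gt0 ?prime_gt0 // oddX p_odd orbT.
rewrite -chiS -gauss_mxE // /gauss_mx.
(* Sum over coordinate vectors v instead: at x = [lin_comb charF e v] the trace of T x^2 is v S
   v^T. *)
rewrite (reindex_onto (lin_comb charF e) h) /=; last by move=> x xA; apply: hK.
apply: eq_big => [v|v _]; first by rewrite eA eK eqxx.
rewrite (_ : trF _ _ _ _ _ = iota ((v *m S *m v^T) 0 0)) ?prime_repK //.
have -> : iota ((v *m S *m v^T) 0 0) = map_mx iota (v *m S *m v^T) 0 0 by rewrite [RHS]mxE.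
rewrite !map_mxM ES -matrix.map_trmx /trF divn1 !mulmxA.
rewrite -[_ *m E^T *m _]mulmxA -trmx_mul mul_mx_diag mxE.
apply: eq_bigr => j _; rewrite [in RHS]mxE [_^T _ _]mxE lin_comb_moore mxE mul1n exprMn.
by rewrite expr2 exprMn; ring.
Qed.
End SubfieldGauss.

(** * Counting solutions *)

Section SolutionCount.
Variables (R : realType) (F : finFieldType) (p n : nat).
Hypotheses (p_pr : prime p) (p_odd : odd p) (n_gt0 : (0 < n)%N).
Hypothesis cardF : #|F| = (p ^ n)%N.
Local Notation zeta := (zeta R p).

Let charF : p \in [pchar F] := card_finPcharP cardF p_pr.
Local Notation iota := (Fp_embed charF).
Local Notation zeta_prim := (zeta_prim_root R p_pr p_odd).

Definition add_char (y : F) : R[i] := zeta ^+ prime_rep F p (trF F p n 1 y).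

Lemma psiE c x : psi R F p n c x = add_char (c * x).
Proof.
rewrite /psi /add_char /zeta cisX /cis; set k := prime_rep _ _ _.
by rewrite (_ : k%:R * (2 * pi / p%:R) = 2 * pi * k%:R / p%:R) // mulrCA mulrA.
Qed.

Lemma trF1_embed y : exists k, trF F p n 1 y = iota k.
Proof.
apply: Fp_embedP; have := trF_subF charF (dvd1n n) (frob_card cardF y).
by rewrite inE expn1 => /eqP.
Qed.

Lemma add_char_embed y k : trF F p n 1 y = iota k -> add_char y = echar zeta k.
Proof. by rewrite /add_char => ->; rewrite prime_repK. Qed.

Lemma trFD t x y : trF F p n t (x + y) = trF F p n t x + trF F p n t y.
Proof. by rewrite /trF -big_split; apply: eq_bigr => i _; rewrite (frobD charF). Qed.

Lemma add_charD x y : add_char (x + y) = add_char x * add_char y.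
Proof.
have [k Ek] := trF1_embed x; have [l El] := trF1_embed y.
rewrite (add_char_embed Ek) (add_char_embed El) -(echarD p_pr zeta_prim).
by apply: add_char_embed; rewrite trFD Ek El rmorphD.
Qed.

Lemma add_char0 : add_char 0 = 1.
Proof.
rewrite (@add_char_embed 0 0) ?echar0 // rmorph0 /trF big1 // => i _.
by rewrite expr0n gtn_eqF ?expn_gt0 ?prime_gt0.
Qed.

Lemma add_char_nontrivial : exists x, add_char x != 1.
Proof.
have [x tx] : exists x, trF F p n 1 x != 0.
  apply/existsP; apply/contraT => /existsPn tr0.
  (* The trace to F_p is an additive polynomial with all coefficients 1, so it cannot vanish on all
     of [F], which is the case t = n. *)
  have := @additive_poly_eq0 F p n n p_pr n_gt0 (dvdnn n) cardF (fun=> 1) _ (Ordinal n_gt0).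
  suff H : forall x, x \in subF F p n -> \sum_(j < n) 1 * x ^+ (p ^ j) = 0.
    by move/(_ H)/eqP; rewrite oner_eq0.
  move=> x _; have := tr0 x; rewrite negbK /trF divn1 => /eqP trx; rewrite -[RHS]trx.
  by apply: eq_bigr => i _; rewrite mul1r mul1n.
exists x; have [k Ek] := trF1_embed x; rewrite (add_char_embed Ek) /echar.
rewrite -(prim_order_dvd zeta_prim); apply: contra tx => pk.
by rewrite Ek /Fp_embed -(dvdn_pcharf charF).
Qed.

Lemma sum_add_char y : \sum_c add_char (c * y) = if y == 0 then (p ^ n)%:R else 0.
Proof.
case: eqP => [->|/eqP y0].
  by under eq_bigr do rewrite mulr0 add_char0; rewrite sumr_const -cardF.
rewrite -(reindex_inj (mulIf y0) (P := predT) (F := add_char)) /=.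
have [x x1] := add_char_nontrivial.
apply: (mulfI (_ : add_char x - 1 != 0)); rewrite ?subr_eq0 // mulr0 mulrBl mul1r.
apply/eqP; rewrite subr_eq0; apply/eqP.
rewrite [RHS](reindex_inj (addrI x)) mulr_sumr; apply: eq_bigr => c _ /=.
by rewrite add_charD.
Qed.

(** Matches the parity in [gauss_zeta] with the case distinction modulo 4 in [Gamma]. *)
Lemma odd_half_mod4 : odd p.-1./2 = (p %% 4 != 1)%N.
Proof.
have := odd_mod p (erefl : odd 4 = false); rewrite p_odd.
move: (divn_eq p 4) (ltn_pmod p (isT : (0 < 4)%N)); move: (p %/ 4)%N => d.
rewrite -[4%N]/(2 * 2)%N mulnA muln2; case: (p %% _)%N => [|[|[|[|r]]]] //= -> _ _.
  by rewrite addn1 /= doubleK muln2 odd_double.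
by rewrite addn3 /= doubleK muln2 /= odd_double.
Qed.

(** If T = 0, all p^t terms are 1 and the two factors p^(t/2) multiply to p^t. Otherwise the sum is
    a signed g^t, whose absolute value p^(t/2) is the prefactor. *)
Lemma gamma_sum t u c : (0 < t)%N -> (t %| n)%N ->
  (Num.sqrt p%:R ^+ t)%:C%C * Gamma R F p n t u c =
  \sum_(y in subF F p t) add_char (c * (u * y ^+ 2)).
Proof.
move=> t_gt0 tn; rewrite /Gamma; set T := trF F p n t (c * u).
have TA : T \in subF F p t by apply: (trF_subF charF tn); apply: frob_card.
rewrite (eq_bigr (fun y => zeta ^+ prime_rep F p (trF F p t 1 (T * y ^+ 2)))); last first.
  move=> y yA; rewrite /add_char mulrA (trF_tower tn charF) //.
  by apply/subFP; rewrite exprAC (subFP _ _ _ yA).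
have sq : (Num.sqrt p%:R ^+ t)%:C%C * (Num.sqrt p%:R ^+ t)%:C%C = (p ^ t)%:R :> R[i].
  by rewrite -rmorphM -exprMn -expr2 sqr_sqrtr ?ler0n // -natrX rmorph_nat.
case: eqP => [T0|/eqP T0].
  rewrite -complexr0 sq (eq_bigr (fun=> 1)) => [|y _].
    by rewrite sumr_const (card_subF p_pr t_gt0 tn cardF).
  rewrite T0 mul0r (_ : trF _ _ _ _ _ = iota 0) ?prime_repK ?expr0 //.
  rewrite rmorph0 /trF big1 // => i _.
  by rewrite expr0n gtn_eqF ?expn_gt0 ?prime_gt0.
rewrite (gauss_subF p_pr p_odd t_gt0 tn cardF charF zeta_prim TA T0).
rewrite gauss_zeta // odd_half_mod4 /qchar (negbTE T0) exprMn rmorphXn /=.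
have -> : - (-1) ^+ t = (-1) ^+ t.-1 :> R[i].
  by rewrite -[in LHS](prednK t_gt0) exprS mulN1r opprK.
case: eqP => _ /=; first by rewrite expr1n mulr1 mulrC.
by rewrite [RHS]mulrC -!mulrA; congr (_ * _); rewrite mulrCA.
Qed.

Lemma solution_count s (a : 'I_s -> F) (b : F) (t : 'I_s -> nat)
    (ht : forall j, (0 < t j)%N && (t j %| n)%N) :
  #|[set x : {ffun 'I_s -> F} | [forall j, x j \in subF F p (t j)] &&
        (\sum_(j < s) a j * x j ^+ 2 == b)]|%:R * (p ^ n)%:R =
  (Num.sqrt p%:R ^+ (\sum_(j < s) t j))%:C%C *
    \sum_(c : F) psi R F p n c (- b) * \prod_(j < s) Gamma R F p n (t j) (a j) c.
Proof.
pose Q := [pred x : {ffun 'I_s -> F} | [forall j, x j \in subF F p (t j)]].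
have E c : (Num.sqrt p%:R ^+ (\sum_(j < s) t j))%:C%C *
      (psi R F p n c (- b) * \prod_(j < s) Gamma R F p n (t j) (a j) c) =
    \sum_(x | Q x) add_char (c * (\sum_(j < s) a j * x j ^+ 2 - b)).
  rewrite psiE mulrCA -prodrXr rmorph_prod -big_split /=.
  rewrite (eq_bigr (fun j =>
    \sum_(y in subF F p (t j)) add_char (c * (a j * y ^+ 2)))); last first.
    by move=> j _; have /andP[t0 tn] := ht j; apply: gamma_sum.
  (* The product over j of sums over subfields expands into a sum over tuples. *)
  rewrite bigA_distr_big_dep mulr_sumr; apply: eq_big => [x|x _]; first exact/familyP/forallP.
  rewrite mulrBr -mulrN addrC add_charD mulr_sumr; congr (_ * _).
  by rewrite (big_morph _ add_charD add_char0).
rewrite mulr_sumr (eq_bigr _ (fun c _ => E c)) exchange_big /=.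
(* Orthogonality: the sum over c is q for each tuple solving the equation and 0 for every other
   tuple. *)
under eq_bigr do rewrite sum_add_char subr_eq0.
rewrite -big_mkcondr /= sumr_const -[RHS]mulr_natl; congr (_%:R * _).
by apply: eq_card => x; rewrite inE.
Qed.
End SolutionCount.

Unset Implicit Arguments.

Theorem theorem5p3 (R : realType) (F : finFieldType) (p n s : nat)
    (hp : prime p) (hodd : odd p) (hn : (0 < n)%N) (hq : #|F| = (p ^ n)%N)
    (a : 'I_s -> F) (b : F) (t : 'I_s -> nat)
    (ht : forall j, (0 < t j)%N && (t j %| n)%N) :
  (#|[set x : {ffun 'I_s -> F} |
        [forall j, x j \in subF F p (t j)] &&
        (\sum_(j < s) a j * x j ^+ 2 == b)]|)%:R
  = Complex ((Num.sqrt (p%:R : R)) ^+ (\sum_(j < s) t j) / (p%:R) ^+ n) 0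
    * \sum_(c : F) psi R F p n c (- b) * \prod_(j < s) Gamma R F p n (t j) (a j) c.
Proof.
have p0 : p%:R != 0 :> R by rewrite pnatr_eq0 -lt0n prime_gt0.
have q0 : (p ^ n)%:R != 0 :> R[i] by rewrite pnatr_eq0 -lt0n expn_gt0 prime_gt0.
apply: (mulIf q0); rewrite (solution_count R hp hodd hn hq a b ht).
rewrite complexr0 mulrAC; congr (_ * _).
by rewrite -(rmorph_nat (real_complex R)) -rmorphM natrX divfK ?expf_neq0.
Qed.
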